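(* Let $(M^{2n+1},\phi,\xi,\eta,g)$ be a $(\kappa,\mu)$-almost co-Kähler manifold that admits a $\beta$-almost Ricci soliton with potential vector field $\xi$, i.e. there are functions $\beta,\lambda:M\to\mathbb{R}$ such that $\beta\,\mathcal{L}_{\xi}g+2S+2\lambda g=0$, where $S$ is the Ricci tensor of $g$. Suppose that $\xi$ is torse forming, i.e. $\nabla_X\xi=fX+\theta(X)\xi$ for all vector fields $X$ on $M$, where $f\in C^\infty(M)$ and $\theta$ is a $1$-form. Then $\xi$ is concurrent and $M$ is $\eta$-Einstein. Moreover, if $f$ is constant, then $\kappa\le 0$ and $f^2=-2\kappa$.
   Context: An almost contact metric structure $(\phi,\xi,\eta,g)$ on a smooth $(2n+1)$-dimensional Riemannian manifold $(M,g)$ consists of a $(1,1)$-tensor field $\phi$, a unit vector field $\xi$ (the Reeb vector field) and a $1$-form $\eta$ with $\phi^2=-I+\eta\otimes\xi$, $\eta(\xi)=1$, $\phi\xi=0$, $\eta\circ\phi=0$, and $g(\phi X,\phi Y)=g(X,Y)-\eta(X)\eta(Y)$ for all vector fields $X,Y$ (so $g(X,\xi)=\eta(X)$). Put $\Phi(X,Y)=g(X,\phi Y)$. The manifold is almost co-Kähler if both $\eta$ and $\Phi$ are closed. Put $h=\tfrac12\mathcal{L}_{\xi}\phi$, where $\mathcal{L}$ denotes the Lie derivative. An almost co-Kähler manifold is a $(\kappa,\mu)$-almost co-Kähler manifold, with $\kappa,\mu\in\mathbb{R}$, if its curvature tensor $R(X,Y)=\nabla_X\nabla_Y-\nabla_Y\nabla_X-\nabla_{[X,Y]}$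 satisfies $R(X,Y)\xi=\kappa[\eta(Y)X-\eta(X)Y]+\mu[\eta(Y)hX-\eta(X)hY]$ for all vector fields $X,Y$. $\nabla$ is the Levi-Civita connection. In this paper a vector field $V$ is called concurrent if $\nabla_XV=0$ for every vector field $X$ on $M$. The manifold $M$ is $\eta$-Einstein if $S=a\,g+b\,\eta\otimes\eta$ for some smooth functions $a,b$ on $M$. *)

(* Defs.v *)
From HB Require Import structures.
From mathcomp Require Import all_boot all_order all_algebra.
From mathcomp Require Import all_classical all_reals all_analysis.
From mathcomp Require Import ring.
Set Implicit Arguments.
Unset Strict Implicit.
Unset Printing Implicit Defensive.
Import Order.TTheory GRing.Theory Num.Theory.
Import numFieldNormedType.Exports.
Local Open Scope classical_set_scope.
Local Open Scope ring_scope.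

Section SmoothOn.
Context {R : realType} {m : nat}.
Implicit Types (O : set 'rV[R]_m) (f g : 'rV[R]_m -> R).

(* C^k on the open set O; only the values of f on O matter. *)
Fixpoint Ck (k : nat) O f : Prop :=
  (forall x, O x -> {for x, continuous f}) /\
  if k is k'.+1 then
    forall i : 'I_m, (forall x, O x -> derivable f x (delta_mx 0 i)) /\
                     Ck k' O ('D_(delta_mx 0 i) f)
  else True.

Definition smooth_on O f := forall k, Ck k O f.

Lemma CkS k O f : Ck k.+1 O f -> Ck k O f.
Proof.
elim: k f => [|k IHk] f [cf df]; split => // i.
by have [d1 /IHk d2] := df i.
Qed.

Lemma eq_Ck k O f g : open O -> (forall x, O x -> f x = g x) ->
  Ck k O f -> Ck k O g.
Proof.
move=> oO; elim: k f g => [|k IHk] f g fg [cf df];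
  have nfg x : O x -> \near x, f x = g x by
    move=> Ox; apply: filterS (open_nbhs_nbhs (conj oO Ox)) => y /fg.
all: split=> [x Ox|//].
1,2: rewrite /prop_for /continuous_at -(fg _ Ox).
1,2: by apply: cvg_trans (cf _ Ox); apply: near_eq_cvg;
  [exact: (nbhs_filter x)|exact: nfg].
move=> i; have [d1 d2] := df i; split=> [x Ox|].
  by apply: near_eq_derivable (d1 _ Ox) => //; exact: nfg.
by apply: IHk d2 => x Ox; apply: near_eq_derive => //; exact: nfg.
Qed.

Lemma Ck_cst k O (a : R) : open O -> Ck k O (cst a).
Proof.
move=> oO; elim: k a => [|k IHk] a; (split; first by move=> x _; exact: cst_continuous) => //.
move=> i; split=> [x _|]; first exact: derivable_cst.
by apply: eq_Ck (IHk 0) => // x _; rewrite derive_cst.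
Qed.

Lemma CkB k O f g : open O -> Ck k O f -> Ck k O g -> Ck k O (f - g).
Proof.
move=> oO; elim: k f g => [|k IHk] f g [cf df] [cg dg];
  (split; first by move=> x Ox; apply: continuousB; [exact: cf|exact: cg]) => //.
move=> i; have [f1 f2] := df i; have [g1 g2] := dg i; split=> [x Ox|].
  by apply: derivableB; [exact: f1|exact: g1].
apply: eq_Ck (IHk _ _ f2 g2) => // x Ox.
by rewrite deriveB //; [exact: f1|exact: g1].
Qed.

Lemma CkD k O f g : open O -> Ck k O f -> Ck k O g -> Ck k O (f + g).
Proof.
move=> oO Cf Cg; have Cn : Ck k O (cst 0 - g) by apply: CkB => //; exact: Ck_cst.
by apply: eq_Ck (CkB oO Cf Cn) => // x _; rewrite !fctE sub0r opprK.
Qed.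

Lemma CkM k O f g : open O -> Ck k O f -> Ck k O g -> Ck k O (f * g).
Proof.
move=> oO; elim: k f g => [|k IHk] f g Cf Cg;
  move: (Cf) (Cg) => [cf df] [cg dg];
  (split; first by move=> x Ox; apply: continuousM; [exact: cf|exact: cg]) => //.
move=> i; have [f1 f2] := df i; have [g1 g2] := dg i; split=> [x Ox|].
  by apply: derivableM; [exact: f1|exact: g1].
apply: eq_Ck (CkD oO (IHk _ _ (CkS Cf) g2) (IHk _ _ (CkS Cg) f2)) => // x Ox.
by rewrite deriveM //; [exact: f1|exact: g1].
Qed.

End SmoothOn.

(* [chart_inv] is only meaningful on the open image of the chart. *)
Record chart (R : realType) (m : nat) (M : topologicalType) := Chart {
  chart_dom : set M;
  chart_map : M -> 'rV[R]_m;
  chart_inv : 'rV[R]_m -> M;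
  chart_img := chart_map @` chart_dom;
  chart_dom_open : open chart_dom;
  chart_img_open : open chart_img;
  chart_mapK : forall p, chart_dom p -> chart_inv (chart_map p) = p;
  chart_map_cont : forall p, chart_dom p -> {for p, continuous chart_map};
  chart_inv_cont : forall x, chart_img x -> {for x, continuous chart_inv} }.

Definition chart_compatible (R : realType) (m : nat) (M : topologicalType)
    (c d : chart R m M) : Prop :=
  forall j : 'I_m,
    smooth_on (chart_map c @` (chart_dom c `&` chart_dom d))
      (fun x => chart_map d (chart_inv c x) 0 j).

Record manifold (R : realType) (m : nat) := Manifold {
  manifold_space :> topologicalType;
  manifold_nonempty : [set: manifold_space] !=set0;
  manifold_hausdorff : hausdorff_space manifold_space;
  manifold_second_countable : @second_countable manifold_space;
  atlas : set (chart R m manifold_space);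
  atlas_cover : forall p, exists2 c, atlas c & chart_dom c p;
  atlas_compatible : forall c d, atlas c -> atlas d -> chart_compatible c d }.

Section Calculus.
Context {R : realType} {m : nat} (M : manifold R m).

Definition smooth_fun_subdef : {pred M -> R} := fun u => `[<
  forall c, atlas c -> smooth_on (chart_img c) (u \o chart_inv c) >].

Lemma smooth_fun_subring : subring_closed smooth_fun_subdef.
Proof.
split=> [|u v /asboolP Su /asboolP Sv|u v /asboolP Su /asboolP Sv];
  apply/asboolP => c ac k; have oc := @chart_img_open _ _ _ c.
- exact: Ck_cst.
- exact: CkB oc (Su c ac k) (Sv c ac k).
- exact: CkM oc (Su c ac k) (Sv c ac k).
Qed.

HB.instance Definition _ :=
  GRing.isSubringClosed.Build (M -> R) smooth_fun_subdef smooth_fun_subring.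

Record smooth_fun := SmoothFun {
  smooth_fun_val :> M -> R;
  smooth_funP : smooth_fun_val \in smooth_fun_subdef }.

HB.instance Definition _ := [isSub for smooth_fun_val].
HB.instance Definition _ := [Choice of smooth_fun by <:].
HB.instance Definition _ :=
  GRing.SubChoice_isSubComPzRing.Build _ _ smooth_fun (subringClosedP _).

Lemma smooth_cst_subproof (a : R) : (cst a : M -> R) \in smooth_fun_subdef.
Proof.
by apply/asboolP => c ac k; exact: Ck_cst (@chart_img_open _ _ _ c).
Qed.

Definition smooth_cst (a : R) : smooth_fun :=
  SmoothFun (smooth_cst_subproof a).

(* Vector fields are the R-linear derivations of C^oo(M); they form a module
   over C^oo(M). *)
Definition derivation_subdef : {pred smooth_fun -> smooth_fun^o} := fun X => `[<
  (forall a u v, X (smooth_cst a * u + v) = smooth_cst a * X u + X v) /\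
  (forall u v, X (u * v) = u * X v + v * X u) >].

Lemma derivation_submod : submod_closed derivation_subdef.
Proof.
split=> [|w X Y /asboolP[XL XD] /asboolP[YL YD]]; apply/asboolP; split.
- by move=> a u v;
  change (0 = smooth_cst a * 0 + 0 :> smooth_fun); rewrite mulr0 addr0.
- by move=> u v;
  change (0 = u * 0 + v * 0 :> smooth_fun); rewrite !mulr0 addr0.
- move=> a u v; change (w * X (smooth_cst a * u + v) + Y (smooth_cst a * u + v) =
    smooth_cst a * (w * X u + Y u) + (w * X v + Y v) :> smooth_fun).
  by rewrite XL YL !mulrDr addrACA mulrCA.
- move=> u v; change (w * X (u * v) + Y (u * v) =
    u * (w * X v + Y v) + v * (w * X u + Y u) :> smooth_fun).
  by rewrite XD YD !mulrDr addrACA ![w * (_ * _)]mulrCA.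
Qed.

HB.instance Definition _ := GRing.isSubmodClosed.Build smooth_fun
  (smooth_fun -> smooth_fun^o) derivation_subdef derivation_submod.

Record vfield := VField {
  vfield_val :> smooth_fun -> smooth_fun^o;
  vfieldP : vfield_val \in derivation_subdef }.

HB.instance Definition _ := [isSub for vfield_val].
HB.instance Definition _ := [Choice of vfield by <:].
HB.instance Definition _ := [SubChoice_isSubLmodule of vfield by <:].

Lemma vfieldZD (X : vfield) a u v :
  X (smooth_cst a * u + v) = smooth_cst a * X u + X v.
Proof. by have /asboolP[XL _] := vfieldP X; exact: XL. Qed.

Lemma vfield_leibniz (X : vfield) u v : X (u * v) = u * X v + v * X u.
Proof. by have /asboolP[_ XD] := vfieldP X; exact: XD. Qed.

Lemma vfieldD (X : vfield) u v : X (u + v) = X u + X v.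
Proof.
have e1 : smooth_cst 1 = 1 by apply: val_inj.
by have := vfieldZD X 1 u v; rewrite e1 !mul1r.
Qed.

Lemma leibniz_bracket (K : comPzRingType) (u v xy yx xy' yx' xu xv yu yv : K) :
  (u * xy + yv * xu + (v * xy' + yu * xv))
    - (u * yx + xv * yu + (v * yx' + xu * yv)) =
  u * (xy - yx) + v * (xy' - yx').
Proof. by ring. Qed.

Lemma lie_bracket_subproof (X Y : vfield) :
  (fun u => (X (Y u) - Y (X u) : smooth_fun)) \in derivation_subdef.
Proof.
apply/asboolP; split=> [a u v|u v].
  rewrite !vfieldZD !mulrBr opprD addrACA; congr (_ + _).
rewrite !vfield_leibniz !vfieldD !vfield_leibniz.
exact: leibniz_bracket.
Qed.

(* [X, Y] = X o Y - Y o X as derivations. *)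
Definition lie_bracket (X Y : vfield) : vfield :=
  VField (lie_bracket_subproof X Y).

Implicit Types (g S : vfield -> vfield -> smooth_fun) (X Y Z xi : vfield)
  (nabla : vfield -> vfield -> vfield) (eta : {linear vfield -> smooth_fun^o})
  (phi : {linear vfield -> vfield}).

(* X vanishes at p, as a tangent vector, iff it kills all smooth functions
   there. *)
Record riemannian_metric g : Prop := {
  metric_linearl : forall u X Y Z, g (u *: X + Y) Z = u * g X Z + g Y Z;
  metric_sym : forall X Y, g X Y = g Y X;
  metric_pos : forall X p, (exists u, X u p != 0) -> 0 < g X X p }.

Record levi_civita g nabla : Prop := {
  nabla_linearl : forall u X Y Z,
    nabla (u *: X + Y) Z = u *: nabla X Z + nabla Y Z;
  nablaDr : forall X Y Z, nabla X (Y + Z) = nabla X Y + nabla X Z;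
  nabla_leibniz : forall X u Y,
    nabla X (u *: Y) = (X u : smooth_fun) *: Y + u *: nabla X Y;
  nabla_torsion_free : forall X Y, nabla X Y - nabla Y X = lie_bracket X Y;
  nabla_metric : forall X Y Z,
    X (g Y Z) = g (nabla X Y) Z + g Y (nabla X Z) }.

Definition curvature nabla X Y Z : vfield :=
  nabla X (nabla Y Z) - nabla Y (nabla X Z) - nabla (lie_bracket X Y) Z.

Definition orthonormal_at g (p : M) (E : 'I_m -> vfield) : Prop :=
  forall i j, g (E i) (E j) p = (i == j)%:R.

(* S(X, Y) = tr (Z |-> R(Z, X) Y), the trace being computed at each point in
   any family of vector fields that is orthonormal there. *)
Definition is_ricci g nabla S : Prop :=
  forall p E, orthonormal_at g p E -> forall X Y,
    S X Y p = \sum_i g (curvature nabla (E i) X Y) (E i) p.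

Definition lie_metric xi g X Y : smooth_fun :=
  xi (g X Y) - g (lie_bracket xi X) Y - g X (lie_bracket xi Y).

Definition lie_endo xi phi X : vfield :=
  lie_bracket xi (phi X) - phi (lie_bracket xi X).

(* Closedness is stated by the global formula for the exterior derivative, up
   to a constant factor that depends on the convention. *)
Definition closed_1form eta : Prop := forall X Y,
  X (eta Y) - Y (eta X) - eta (lie_bracket X Y) = 0 :> smooth_fun.

Definition closed_2form (Phi : vfield -> vfield -> smooth_fun) : Prop :=
  forall X Y Z,
    X (Phi Y Z) + Y (Phi Z X) + Z (Phi X Y)
    - Phi (lie_bracket X Y) Z - Phi (lie_bracket Y Z) X
    - Phi (lie_bracket Z X) Y = 0 :> smooth_fun.

Record almost_contact_metric phi xi eta g : Prop := {
  acm_metric : riemannian_metric g;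
  acm_unit : g xi xi = 1;
  acm_phi2 : forall X, phi (phi X) = - X + (eta X : smooth_fun) *: xi;
  acm_eta_xi : eta xi = 1 :> smooth_fun;
  acm_phi_xi : phi xi = 0;
  acm_eta_phi : forall X, eta (phi X) = 0;
  acm_compat : forall X Y,
    g (phi X) (phi Y) = g X Y - (eta X : smooth_fun) * eta Y }.

Record almost_coKahler phi xi eta g : Prop := {
  ack_acm : almost_contact_metric phi xi eta g;
  ack_eta_closed : closed_1form eta;
  ack_Phi_closed : closed_2form (fun X Y => g X (phi Y)) }.

Definition h_tensor phi xi X : vfield :=
  smooth_cst 2^-1 *: lie_endo xi phi X.

Record kappa_mu_almost_coKahler (kappa mu : R) phi xi eta g nabla : Prop := {
  km_ack : almost_coKahler phi xi eta g;
  km_levi_civita : levi_civita g nabla;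
  km_curvature : forall X Y,
    curvature nabla X Y xi =
      smooth_cst kappa *: ((eta Y : smooth_fun) *: X - (eta X : smooth_fun) *: Y)
      + smooth_cst mu *: ((eta Y : smooth_fun) *: h_tensor phi xi X
                          - (eta X : smooth_fun) *: h_tensor phi xi Y) }.

(* The functions beta and lambda are not assumed to be smooth. *)
Definition beta_almost_ricci_soliton (beta lambda : M -> R) g S (V : vfield) :
    Prop := forall X Y p,
  beta p * lie_metric V g X Y p + 2 * S X Y p + 2 * lambda p * g X Y p = 0.

Definition torse_forming nabla (V : vfield) (f : smooth_fun)
    (theta : {linear vfield -> smooth_fun^o}) : Prop :=
  forall X, nabla X V = f *: X + (theta X : smooth_fun) *: V.

Definition concurrent nabla (V : vfield) : Prop := forall X, nabla X V = 0.

Definition eta_Einstein g eta S : Prop :=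
  exists a b : smooth_fun, forall X Y,
    S X Y = a * g X Y + b * (eta X * eta Y : smooth_fun).
End Calculus.

(* Main.v *)
Require Import Defs.
From HB Require Import structures.
From mathcomp Require Import all_boot all_order all_algebra.
From mathcomp Require Import all_classical all_reals all_analysis.
From mathcomp Require Import ring.
Set Implicit Arguments.
Unset Strict Implicit.
Unset Printing Implicit Defensive.
Import Order.TTheory GRing.Theory Num.Theory.
Import numFieldNormedType.Exports.
Local Open Scope classical_set_scope.
Local Open Scope ring_scope.

(** Metric compatibility applied to the unit field xi turns the torse-forming
condition into nabla_X xi = f (X - eta(X) xi), so the Lie derivative of g along
xi is 2 f (g - eta (x) eta).  Closedness of Phi, together with phi xi = 0, says
that the flow of xi preserves Phi; comparing with the previous formula,
L_xi phi = -2 f phi ([lie_endo_reeb_phi]).  Closedness of eta says that the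
flow of xi preserves eta, hence also phi^2 = -I + eta (x) xi.  Thus
0 = L_xi (phi^2) = -4 f phi^2 ([torse_factor_phi2]), that is
f (X - eta(X) xi) = 0 for every X, which is nabla xi = 0.

A concurrent field is Killing, so the soliton equation reads S = - lambda g;
evaluating it on (xi, xi) identifies - lambda with the smooth function
S(xi, xi).  Moreover R(X, Y) xi = 0 and h = 0, so the curvature condition
becomes kappa (X - eta(X) xi) = 0.  Therefore, once some vector field X is not
a function multiple of xi, a constant f = c satisfies c = 0, and kappa = 0.

Such an X exists because the dimension is at least two, but as vector fields
are global derivations of the smooth functions it has to be built from bump
functions ([exists_vfield_not_multiple]).  Smoothness being defined by iterated
partial derivatives, this rests on a chain rule in several variables
([Ck_comp]), obtained from a mean value form of the first order expansion
([hadamard]), on the flatness of exp(-1/t) at 0 ([is_derive_flat]), and on the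
fact that functions with compact support in a chart extend by zero to smooth
functions on the manifold ([chart_extension_smooth]). *)

(** * Derivations of the ring of smooth functions *)

Section Fields.
Context {R : realType} {m : nat} (M : manifold R m).
Implicit Types (u v w : smooth_fun M) (X Y Z : vfield M) (a : R).

Lemma vfield_eqP X Y : (forall u, X u = Y u) -> X = Y.
Proof. by move=> XY; apply: val_inj; apply/funext. Qed.

Lemma vfield_one X : X 1 = 0.
Proof.
have := vfield_leibniz X 1 1; rewrite mulr1 mul1r => e.
by apply: (addrI (X 1)); rewrite addr0 -e.
Qed.

Lemma vfield0 X : X 0 = 0.
Proof. by apply: (addrI (X 0)); rewrite -vfieldD !addr0. Qed.

Lemma smooth_fun_double_eq0 u : u + u = 0 -> u = 0.
Proof.
move=> u2; apply: val_inj; apply/funext => p.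
have := congr1 (fun w : smooth_fun M => w p) u2.
rewrite -[(u + u) p]/(u p + u p) -mulr2n -[(0 : smooth_fun M) p]/(0 : R).
by move/eqP; rewrite mulrn_eq0 => /eqP.
Qed.

Lemma vfield_double_eq0 X : X + X = 0 -> X = 0.
Proof.
move=> X2; apply: vfield_eqP => u; apply: smooth_fun_double_eq0.
by have := congr1 (fun Z : vfield M => (Z u : smooth_fun M)) X2.
Qed.

Lemma smooth_cst_scale_eq0 a X : a != 0 -> smooth_cst M a *: X = 0 -> X = 0.
Proof.
move=> a0 /(congr1 (GRing.scale (smooth_cst M a^-1))).
rewrite scaler0 scalerA (_ : _ * _ = 1) ?scale1r //.
by apply: val_inj; apply/funext => p; exact: mulVf.
Qed.

Lemma lie_bracketDr X Y Z :
  lie_bracket X (Y + Z) = lie_bracket X Y + lie_bracket X Z.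
Proof.
apply: vfield_eqP => u.
rewrite -[LHS]/(X (Y u + Z u) - (Y (X u) + Z (X u)) : smooth_fun M).
by rewrite vfieldD opprD addrACA.
Qed.

Lemma lie_bracketZr X u Y :
  lie_bracket X (u *: Y) = (X u : smooth_fun M) *: Y + u *: lie_bracket X Y.
Proof.
apply: vfield_eqP => w.
rewrite -[LHS]/(X (u * Y w) - u * Y (X w) : smooth_fun M).
rewrite -[RHS]/((X u : smooth_fun M) * Y w + u * (X (Y w) - Y (X w))).
by rewrite vfield_leibniz mulrBr addrA [_ * X u]mulrC [in RHS]addrC; ring.
Qed.

Lemma lie_bracketC X Y : lie_bracket Y X = - lie_bracket X Y.
Proof. by apply: vfield_eqP => w; exact: esym (opprB _ _). Qed.

Lemma lie_bracketNr X Y : lie_bracket X (- Y) = - lie_bracket X Y.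
Proof.
apply/eqP; rewrite -addr_eq0 -lie_bracketDr addNr.
apply/eqP/vfield_eqP => w.
by rewrite -[LHS]/(X 0 - 0 : smooth_fun M) vfield0 subr0.
Qed.

Lemma lie_bracketXX X : lie_bracket X X = 0.
Proof. by apply: vfield_eqP => w; exact: subrr. Qed.

End Fields.

(** * Riemannian metrics *)

Section Metric.
Context {R : realType} {m : nat} (M : manifold R m).
Variable g : vfield M -> vfield M -> smooth_fun M.
Hypothesis gP : riemannian_metric g.
Implicit Types (u : smooth_fun M) (X Y Z : vfield M).

Lemma metricDl X Y Z : g (X + Y) Z = g X Z + g Y Z.
Proof. by rewrite -[X]scale1r (metric_linearl gP) mul1r scale1r. Qed.

Lemma metric0l Z : g 0 Z = 0.
Proof. by apply: (addrI (g 0 Z)); rewrite -metricDl !addr0. Qed.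

Lemma metricZl u X Z : g (u *: X) Z = u * g X Z.
Proof. by rewrite -[u *: X]addr0 (metric_linearl gP) metric0l addr0. Qed.

Lemma metricNl X Z : g (- X) Z = - g X Z.
Proof. by rewrite -scaleN1r metricZl mulN1r. Qed.

Lemma metricDr X Y Z : g X (Y + Z) = g X Y + g X Z.
Proof. by rewrite !(Defs.metric_sym gP X) metricDl. Qed.

Lemma metric0r Z : g Z 0 = 0.
Proof. by rewrite (Defs.metric_sym gP) metric0l. Qed.

Lemma metricZr u X Z : g X (u *: Z) = u * g X Z.
Proof. by rewrite !(Defs.metric_sym gP X) metricZl. Qed.

Lemma metricNr X Z : g X (- Z) = - g X Z.
Proof. by rewrite !(Defs.metric_sym gP X) metricNl. Qed.

(** A derivation that is not zero moves some function at some point, and there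
positivity applies to g(Z, Z). *)
Lemma metric_nondegenerate Z : (forall X, g X Z = 0) -> Z = 0.
Proof.
move=> gZ; apply: vfield_eqP => u; apply: val_inj; apply/funext => p.
apply/eqP/negPn/negP => Zu0.
have /(metric_pos gP) : exists u, Z u p != 0 by exists u.
by rewrite gZ ltxx.
Qed.

End Metric.

(** * Torse-forming Reeb fields *)

Section TorseForming.
Context {R : realType} {m : nat} (M : manifold R m).
Variables (phi : {linear vfield M -> vfield M}) (xi : vfield M)
  (eta : {linear vfield M -> (smooth_fun M)^o})
  (g : vfield M -> vfield M -> smooth_fun M)
  (nabla : vfield M -> vfield M -> vfield M)
  (f : smooth_fun M) (theta : {linear vfield M -> (smooth_fun M)^o}).
Hypothesis ack : almost_coKahler phi xi eta g.
Hypothesis lc : levi_civita g nabla.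
Hypothesis tf : torse_forming nabla xi f theta.
Implicit Types (u : smooth_fun M) (X Y Z : vfield M).

Let acm := ack_acm ack.
Let gP := acm_metric acm.
(* [eta] with values in the ring, rather than in the regular module. *)
Let eta' X : smooth_fun M := eta X.

Lemma metric_reeb X : g X xi = eta' X.
Proof.
have := acm_compat acm X xi.
rewrite (acm_phi_xi acm) (metric0r gP) (acm_eta_xi acm) mulr1 => /esym/eqP.
by rewrite subr_eq0 => /eqP.
Qed.

Lemma reeb_metric X : g xi X = eta' X.
Proof. by rewrite (Defs.metric_sym gP) metric_reeb. Qed.

Lemma metric_phi_skew X Y : g (phi X) Y = - g X (phi Y).
Proof.
have := acm_compat acm X (phi Y).
rewrite (acm_eta_phi acm) mulr0 subr0 => <-.
rewrite (acm_phi2 acm) (metricDr gP) (metricNr gP) (metricZr gP) metric_reeb.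
by rewrite /eta' (acm_eta_phi acm) mulr0 addr0 opprK.
Qed.

(** Since g(xi, xi) is constant, nabla_X xi is orthogonal to xi, which forces
theta = - f eta. *)
Lemma torse_forming_reebE X : nabla X xi = f *: (X - eta' X *: xi).
Proof.
have := nabla_metric lc X xi xi.
rewrite (acm_unit acm) vfield_one (Defs.metric_sym gP xi) => /esym.
move=> /smooth_fun_double_eq0.
rewrite tf (metricDl gP) !(metricZl gP) (acm_unit acm) mulr1.
rewrite metric_reeb addrC => /eqP; rewrite addr_eq0 => /eqP ->.
by rewrite scalerBr scaleNr scalerA.
Qed.

(** As eta(xi) is constant, closedness of eta says that L_xi eta = 0. *)
Lemma reeb_eta X : xi (eta X) = eta (lie_bracket xi X).
Proof.
have := ack_eta_closed ack xi X.
by rewrite (acm_eta_xi acm) vfield_one subr0 => /eqP; rewrite subr_eq0 => /eqP.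
Qed.

Lemma nabla_reeb X : nabla xi X = lie_bracket xi X + nabla X xi.
Proof. by rewrite -(nabla_torsion_free lc) subrK. Qed.

(** By Cartan's formula L_xi Phi = 0.  Expanding it as
(L_xi g)(Z, phi X) + g(Z, (L_xi phi) X), the first term is 2 f g(Z, phi X). *)
Lemma lie_endo_reeb_phi X : lie_endo xi phi X = - (f *: phi X + f *: phi X).
Proof.
apply/eqP; rewrite -addr_eq0; apply/eqP.
apply: (metric_nondegenerate gP) => Z.
have := ack_Phi_closed ack xi Z X.
rewrite (acm_phi_xi acm) !(metric0r gP) reeb_metric /eta' (acm_eta_phi acm).
rewrite !vfield0 !addr0 subr0 (lie_bracketC xi X) (metricNl gP) opprK.
rewrite (nabla_metric lc) !nabla_reeb !torse_forming_reebE.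
rewrite !(metricDl gP, metricDr gP, metricZl gP, metricZr gP, metricNl gP, metricNr gP).
rewrite reeb_metric /eta' (acm_eta_phi acm).
have -> : g (lie_bracket xi X) (phi Z) = - g Z (phi (lie_bracket xi X)).
  by rewrite (Defs.metric_sym gP Z) metric_phi_skew opprK.
by move=> <-; ring.
Qed.

(** L_xi is a derivation and kills phi^2, because phi^2 is built from eta and
xi; on the other hand L_xi (phi^2) is -4 f phi^2. *)
Lemma torse_factor_phi2 X : f *: phi (phi X) = 0.
Proof.
have L2 : phi (lie_endo xi phi X) + lie_endo xi phi (phi X) = 0.
  rewrite /lie_endo raddfB /= addrC subrKA !(acm_phi2 acm).
  rewrite lie_bracketDr lie_bracketNr lie_bracketZr lie_bracketXX scaler0 addr0.
  by rewrite reeb_eta opprD opprK addrACA addNr add0r subrr.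
move: L2; rewrite !lie_endo_reeb_phi raddfN raddfD /= linearZ /= -opprD => /eqP.
rewrite oppr_eq0 => /eqP F4.
by apply: vfield_double_eq0; exact: vfield_double_eq0.
Qed.

Lemma torse_factor_horizontal X : f *: (X - eta' X *: xi) = 0.
Proof.
have := torse_factor_phi2 X; rewrite (acm_phi2 acm) => e.
by rewrite -[X in _ *: X]opprB scalerN addrC e oppr0.
Qed.

Lemma torse_forming_reeb_concurrent : concurrent nabla xi.
Proof. by move=> X; rewrite torse_forming_reebE torse_factor_horizontal. Qed.

Lemma torse_forming_h_tensor0 X : h_tensor phi xi X = 0.
Proof.
have fp : f *: phi X = 0.
  have := torse_factor_horizontal (phi X).
  by rewrite /eta' (acm_eta_phi acm) scale0r subr0.
by rewrite /h_tensor lie_endo_reeb_phi fp addr0 oppr0 scaler0.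
Qed.

End TorseForming.

(** * Concurrent fields *)

Section Concurrent.
Context {R : realType} {m : nat} (M : manifold R m).
Variables (g : vfield M -> vfield M -> smooth_fun M)
  (nabla : vfield M -> vfield M -> vfield M) (V : vfield M).
Hypothesis lc : levi_civita g nabla.
Hypothesis cV : concurrent nabla V.

Lemma concurrent_lie_metric X Y : lie_metric V g X Y = 0.
Proof.
rewrite /lie_metric (nabla_metric lc) -!(nabla_torsion_free lc) !cV !subr0.
by rewrite addrAC addrK subrr.
Qed.

Lemma concurrent_curvature X Y : curvature nabla X Y V = 0.
Proof.
have n0 Z : nabla Z 0 = 0.
  by apply: (addrI (nabla Z 0)); rewrite -(nablaDr lc) !addr0.
by rewrite /curvature !cV !n0 !subr0.
Qed.

(** The function lambda need not be smooth a priori; it is eliminated by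
evaluating the soliton equation on (V, V). *)
Lemma concurrent_soliton_einstein beta lambda S : g V V = 1 ->
  beta_almost_ricci_soliton beta lambda g S V ->
  forall X Y, S X Y = S V V * g X Y.
Proof.
move=> V1 sol X Y; apply: val_inj; apply/funext => p.
have SE X' Y' : S X' Y' p = - lambda p * g X' Y' p.
  have := sol X' Y' p; rewrite concurrent_lie_metric.
  rewrite -[(0 : smooth_fun M) p]/(0 : R) mulr0 add0r -mulrA -mulrDr => /eqP.
  by rewrite mulf_eq0 pnatr_eq0 /= addr_eq0 mulNr => /eqP.
rewrite -[LHS]/(S X Y p) -[RHS]/(S V V p * g X Y p) !SE V1.
by rewrite -[(1 : smooth_fun M) p]/(1 : R) mulr1.
Qed.
End Concurrent.

(** * The chain rule for functions with continuous partial derivatives *)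

Section Hadamard.
Context {R : realType} {m : nat}.
Implicit Types (F : 'rV[R]_m -> R) (x y z v : 'rV[R]_m) (r : R).

Lemma coord_le_norm x j : `|x 0 j| <= `|x|.
Proof.
rewrite [leRHS]/Num.norm /= mx_normrE; apply/bigmax_geP; right => /=.
by exists (0, j).
Qed.

Lemma norm_le_coord x r : 0 <= r -> (forall j, `|x 0 j| <= r) -> `|x| <= r.
Proof.
move=> r0 xr; rewrite /Num.norm /= mx_normrE; apply/bigmax_leP; split=> //.
by case=> i j _ /=; rewrite ord1.
Qed.

Lemma rv_continuous (T : topologicalType) (h : T -> 'rV[R]_m) (t : T) :
  (forall j, {for t, continuous (fun s => h s 0 j)}) -> {for t, continuous h}.
Proof.
move=> hc; apply/cvgrPdist_le => e e0.
have : \forall s \near t, forall j, `|h t 0 j - h s 0 j| <= e.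
  apply: filter_forall => j.
  by have /cvgrPdist_le/(_ e e0) := hc j.
apply: filterS => s hs; apply: norm_le_coord (ltW e0) _ => j.
by rewrite !mxE; exact: hs.
Qed.

(** Reduces directional derivatives to derivatives of one real variable. *)
Lemma is_derive_lineP (V : normedModType R) (F : V -> R) (z v : V) (t a : R) :
  is_derive (z + t *: v) v F a <-> is_derive t 1 (fun s : R => F (z + s *: v)) a.
Proof.
have E : (fun h : R => h^-1 *: (F (z + (h *: 1 + t) *: v) - F (z + t *: v))) =
         (fun h : R => h^-1 *: (F (h *: v + (z + t *: v)) - F (z + t *: v))).
  apply/funext => h; congr (_ *: (F _ - _)).
  by rewrite scalerDl addrCA [h *: 1]mulr1.
by split=> -[dF DF]; (split; [move: dF|move: DF]);
  rewrite /derivable /derive [in X in X -> _]E || rewrite /derivable /derive E.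
Qed.

(** The mean value theorem along a line, for a parameter s of either sign. *)
Lemma mvt_line F z v (s : R) :
  (forall t : R, `|t| <= `|s| -> derivable F (z + t *: v) v) ->
  exists2 t : R, `|t| <= `|s| & F (z + s *: v) - F z = 'D_v F (z + t *: v) * s.
Proof.
move=> dF; set G := fun t : R => F (z + t *: v).
have dG (t : R) : `|t| <= `|s| -> is_derive t 1 G ('D_v F (z + t *: v)).
  by move=> ts; exact: (is_derive_lineP F z v t _).1 (derivableP (dF t ts)).
have mvt (a b : R) : a <= b -> (forall t, a <= t <= b -> `|t| <= `|s|) ->
    exists2 t : R, `|t| <= `|s| & G b - G a = 'D_v F (z + t *: v) * (b - a).
  move=> ab I; have [||c cab ->] :=
      MVT_segment (f := G) (df := fun t => 'D_v F (z + t *: v)) ab.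
  - move=> t; rewrite in_itv /= => /andP[ta tb]; apply/dG/I.
    by rewrite !ltW.
  - apply: derivable_within_continuous => t; rewrite in_itv /= => /I tI.
    by have := dG _ tI.
  - by exists c => //; apply: I; move: cab; rewrite in_itv.
have G0 : F z = G 0 by rewrite /G scale0r addr0.
rewrite G0 -/(G s); case: (leP 0 s) => s0.
  have [t /andP[t0 ts]|t ts] := mvt _ _ s0; first by rewrite !ger0_norm.
  by rewrite subr0; exists t.
have [t /andP[t0 ts]|t ts E] := mvt _ _ (ltW s0).
  by rewrite !ler0_norm ?lerN2 // ltW.
by exists t => //; rewrite -opprB E sub0r mulrN opprK.
Qed.

(** Go from y0 to y by changing one coordinate at a time, with the mean value
theorem at each step; for the sup norm the path never leaves the ball around
y0 through y. *)
Lemma hadamard_pointwise F y0 y :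
  (forall z j, `|z - y0| <= `|y - y0| -> derivable F z (delta_mx 0 j)) ->
  exists zeta : 'I_m -> 'rV[R]_m, (forall j, `|zeta j - y0| <= `|y - y0|) /\
    F y - F y0 =
      \sum_j 'D_(delta_mx 0 j) F (zeta j) * (y 0 j - y0 0 j).
Proof.
(* [P k] has its first k coordinates from y and the others from y0. *)
move=> dF; pose P k : 'rV[R]_m := \row_i (if (i < k)%N then y 0 i else y0 0 i).
have Pm : P m = y by apply/rowP => i; rewrite mxE ltn_ord.
have P0 : P 0%N = y0 by apply/rowP => i; rewrite mxE.
have PS (j : 'I_m) : P j.+1 = P j + (y 0 j - y0 0 j) *: delta_mx 0 j.
  apply/rowP => i; rewrite !mxE eqxx /= ltnS leq_eqVlt -val_eqE /=.
  have [/val_inj ->|ij] := eqVneq (i : nat) j;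
    by rewrite ?ltnn ?mulr1 ?mulr0 ?addr0 // addrC subrK.
have Pb (j : 'I_m) t : `|t| <= `|y 0 j - y0 0 j| ->
    `|P j + t *: delta_mx 0 j - y0| <= `|y - y0|.
  move=> tj; apply: norm_le_coord => // i; rewrite !mxE eqxx /=.
  have [->|ij] := eqVneq i j.
    rewrite ltnn mulr1 addrAC subrr add0r (le_trans tj) //.
    by have := coord_le_norm (y - y0) j; rewrite !mxE.
  rewrite mulr0 addr0; case: ifP => _; last by rewrite subrr normr0.
  by have := coord_le_norm (y - y0) i; rewrite !mxE.
have step (j : 'I_m) : exists z, `|z - y0| <= `|y - y0| /\
    F (P j.+1) - F (P j) = 'D_(delta_mx 0 j) F z * (y 0 j - y0 0 j).
  have [t tj E|t tj E] := @mvt_line F (P j) (delta_mx 0 j) (y 0 j - y0 0 j).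
    by apply: dF; exact: Pb.
  by exists (P j + t *: delta_mx 0 j); split; [exact: Pb|rewrite PS].
have [zeta zP] := choice step.
exists zeta; split=> [j|]; first by have [] := zP j.
transitivity (\sum_(j < m) (F (P j.+1) - F (P j))).
  by rewrite -(big_mkord xpredT (fun j => F (P j.+1) - F (P j))) telescope_sumr // Pm P0.
by apply: eq_bigr => j _; have [] := zP j.
Qed.

(** First order expansion in the style of Caratheodory: the remainder is
absorbed in coefficients that converge to the partial derivatives, so that the
chain rule becomes a limit of a sum of products. *)
Lemma hadamard F y0 : (\forall z \near y0, forall j, derivable F z (delta_mx 0 j)) ->
  (forall j, {for y0, continuous ('D_(delta_mx 0 j) F)}) ->
  exists A : 'I_m -> 'rV[R]_m -> R,
    (forall j, A j y @[y --> y0] --> 'D_(delta_mx 0 j) F y0) /\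
    \forall y \near y0, F y - F y0 = \sum_j A j y * (y 0 j - y0 0 j).
Proof.
move=> /nbhs_ballP[r /= r0 dF] cF.
have H y : exists zeta : 'I_m -> 'rV[R]_m, ball y0 r y ->
    (forall j, `|zeta j - y0| <= `|y - y0|) /\
    F y - F y0 = \sum_j 'D_(delta_mx 0 j) F (zeta j) * (y 0 j - y0 0 j).
  have [yr|yr] := pselect (ball y0 r y); last by exists (fun _ => 0).
  have [|zeta zP] := @hadamard_pointwise F y0 y; last by exists zeta.
  move=> z j zy; apply: dF; move: yr; rewrite -ball_normE /= distrC => yr.
  by rewrite distrC (le_lt_trans zy).
have [zeta zP] := choice H.
exists (fun j y => 'D_(delta_mx 0 j) F (zeta y j)); split=> [j|]; last first.
  by apply: filterS (nbhsx_ballx y0 r r0) => y /zP[].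
suff cz : zeta y j @[y --> y0] --> y0 by exact: cvg_comp cz (cF j).
apply/(@cvgrPdist_le _ _ _ (nbhs y0) _ (fun y => zeta y j)) => e e0.
have : \forall y \near y0, ball y0 (Num.min r e) y.
  by apply: nbhsx_ballx; rewrite lt_min r0.
apply: filterS => y; rewrite -ball_normE /= lt_min => /andP[yr ye].
rewrite distrC (le_trans ((zP y _).1 j)) // -?ball_normE //.
by rewrite distrC ltW.
Qed.

Lemma is_derive_chain (V : normedModType R) F (h : V -> 'rV[R]_m) (x v : V) :
  (\forall z \near h x, forall j, derivable F z (delta_mx 0 j)) ->
  (forall j, {for h x, continuous ('D_(delta_mx 0 j) F)}) ->
  (forall j, derivable (fun u : V => h u 0 j) x v) ->
  is_derive x v (F \o h)
    (\sum_j 'D_(delta_mx 0 j) F (h x) * 'D_v (fun u : V => h u 0 j) x).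
Proof.
move=> dF cF dh; have [A [cA EA]] := hadamard dF cF.
pose c (t : R) := h (t *: v + x).
have cc : c t @[t --> 0^'] --> h x.
  have cE : h x = c 0 by rewrite /c scale0r add0r.
  rewrite cE; apply/(@continuous_withinNx _ _ _ _).
  apply: rv_continuous => j; apply: differentiable_continuous.
  have /derivable1P/derivable1_diffP := dh j; exact.
have lim : h0^-1 *: (F (c h0) - F (h x)) @[h0 --> 0^'] -->
    \sum_j 'D_(delta_mx 0 j) F (h x) * 'D_v (fun u : V => h u 0 j) x.
  have : \sum_j A j (c t) * (t^-1 *: (c t 0 j - h x 0 j)) @[t --> 0^'] -->
      \sum_j 'D_(delta_mx 0 j) F (h x) * 'D_v (fun u : V => h u 0 j) x.
    apply: cvg_big => [|j _]; first exact: add_continuous.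
    by apply: cvgM; [exact: cvg_comp cc (cA j)|exact: dh j].
  apply: cvg_trans; apply: near_eq_cvg.
  near=> t; have /= Ht : F (c t) - F (h x) =
    \sum_j A j (c t) * (c t 0 j - h x 0 j) by near: t; exact: cc EA.
  by rewrite Ht scaler_sumr; apply: eq_bigr => j _; rewrite -scalerAr.
by split; [exact: cvgP lim|exact: cvg_lim lim].
Unshelve. all: by end_near.
Qed.

End Hadamard.

(** * Closure properties of functions of class C^k *)

Section CkTheory.
Context {R : realType} {m : nat}.
Implicit Types (O U : set 'rV[R]_m) (F G : 'rV[R]_m -> R) (k : nat).

Lemma Ck_local k O F :
  (forall x, O x -> exists U, [/\ open U, U x & Ck k U F]) -> Ck k O F.
Proof.
elim: k F => [|k IHk] F loc.
  by split=> // x /loc[U [_ Ux [cF _]]]; exact: cF.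
split=> [x /loc[U [_ Ux [cF _]]]|i]; first exact: cF.
split=> [x /loc[U [_ Ux [_ /(_ i)[dF _]]]]|]; first exact: dF.
apply: IHk => x /loc[U [oU Ux [_ /(_ i)[_ CF]]]].
by exists U.
Qed.

Lemma Ck_sum k O (I : Type) (r : seq I) (F : I -> 'rV[R]_m -> R) : open O ->
  (forall i, Ck k O (F i)) -> Ck k O (fun x => \sum_(i <- r) F i x).
Proof.
move=> oO CF; elim: r => [|i r IHr].
  by apply: eq_Ck (Ck_cst k 0 oO) => // x _; rewrite big_nil.
by apply: eq_Ck (CkD oO (CF i) IHr) => // x _; rewrite big_cons.
Qed.

Lemma Ck_prod k O (I : Type) (r : seq I) (F : I -> 'rV[R]_m -> R) : open O ->
  (forall i, Ck k O (F i)) -> Ck k O (fun x => \prod_(i <- r) F i x).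
Proof.
move=> oO CF; elim: r => [|i r IHr].
  by apply: eq_Ck (Ck_cst k 1 oO) => // x _; rewrite big_nil.
by apply: eq_Ck (CkM oO (CF i) IHr) => // x _; rewrite big_cons.
Qed.

Lemma is_derive_coord (x v : 'rV[R]_m) (j : 'I_m) :
  is_derive x v (fun y : 'rV[R]_m => y 0 j) (v 0 j).
Proof.
have E : forall h : R, h != 0 -> h^-1 *: ((h *: v + x) 0 j - x 0 j) = v 0 j.
  by move=> h h0; rewrite !mxE addrK [_ *: _]mulrA mulVf ?mul1r.
have lim : h^-1 *: ((h *: v + x) 0 j - x 0 j) @[h --> 0^'] --> v 0 j.
  by apply: cvg_near_cst; near=> h; apply: E; near: h; exact: nbhs_dnbhs_neq.
by split; [exact: cvgP lim|exact: cvg_lim lim].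
Unshelve. all: by end_near. Qed.

Lemma Ck_coord k O (j : 'I_m) : open O -> Ck k O (fun x => x 0 j).
Proof.
move=> oO; case: k => [|k]; (split; first by move=> x _; exact: coord_continuous) => // i.
split=> [x _|]; first by have [] := is_derive_coord x (delta_mx 0 i) j.
apply: eq_Ck (Ck_cst k ((delta_mx 0 i : 'rV[R]_m) 0 j) oO) => // x _.
by rewrite (derive_val (is_derive := is_derive_coord x (delta_mx 0 i) j)).
Qed.

(** Indexing all the iterated derivatives of the outer function by a family
that is stable under derivation makes the induction on k go through. *)
Lemma Ck_comp_family k O (I : Type) (psi : I -> R -> R) (D : I -> I) (i : I) G :
  (forall i (t : R), is_derive t 1 (psi i) (psi (D i) t)) ->
  open O -> Ck k O G -> Ck k O (psi i \o G).
Proof.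
move=> dpsi oO; elim: k i G => [|k IHk] i G CG; move: (CG) => [cG dG];
  have cpsi j : continuous (psi j) by move=> t; apply: differentiable_continuous;
    apply/derivable1_diffP; have [] := dpsi j t.
  by split=> // x Ox; apply: continuous_comp (cG x Ox) (cpsi _ _).
split=> [x Ox|j]; first by apply: continuous_comp (cG x Ox) (cpsi _ _).
have [dG1 dG2] := dG j.
have dc x : O x -> is_derive x (delta_mx 0 j) (psi i \o G)
    (psi (D i) (G x) * 'D_(delta_mx 0 j) G x).
  move=> Ox; set v := delta_mx 0 j; have /derivableP dGx := dG1 x Ox.
  have x0 : x = x + 0 *: v by rewrite scale0r addr0.
  rewrite x0 in dGx *.
  have dl := (is_derive_lineP G x v 0 _).1 dGx.
  apply: (is_derive_lineP (psi i \o G) x v 0 _).2.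
  exact: is_derive1_comp.
split=> [x /dc[]//|].
by apply: eq_Ck (CkM oO (IHk (D i) G (CkS CG)) dG2) => // x /dc[_ ->].
Qed.

End CkTheory.

(** The partial derivatives of F \o h are sums of products of partial
derivatives of h with partial derivatives of F composed with h, to which the
induction hypothesis on k applies. *)
Lemma Ck_comp (R : realType) (m p k : nat) (O : set 'rV[R]_p) (O' : set 'rV[R]_m)
    (F : 'rV[R]_m -> R) (h : 'rV[R]_p -> 'rV[R]_m) : open O -> open O' ->
  (forall x, O x -> O' (h x)) ->
  (forall j, Ck k O (fun x => h x 0 j)) -> Ck k O' F -> Ck k O (F \o h).
Proof.
move=> oO oO' hO; elim: k F => [|k IHk] F Ch CF.
  split=> // x Ox; apply: continuous_comp (CF.1 _ (hO _ Ox)).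
  by apply: rv_continuous => j; exact: (Ch j).1.
split=> [x Ox|i].
  apply: continuous_comp (CF.1 _ (hO _ Ox)).
  by apply: rv_continuous => j; exact: (Ch j).1.
have dc x : O x -> is_derive x (delta_mx 0 i) (F \o h)
    (\sum_j 'D_(delta_mx 0 j) F (h x)
      * 'D_(delta_mx 0 i) (fun y : 'rV[R]_p => h y 0 j) x).
  move=> Ox; apply: is_derive_chain.
  - apply: filterS (open_nbhs_nbhs (conj oO' (hO _ Ox))) => y O'y j.
    exact: (CF.2 j).1.
  - move=> j; have [_ C'] := CF.2 j.
    by case: k {IHk Ch CF} C' => [|k] [+ _]; apply; exact: hO.
  - by move=> j; exact: ((Ch j).2 i).1.
split=> [x /dc[]//|].
have C' : Ck k O (fun x => \sum_j 'D_(delta_mx 0 j) F (h x)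
    * 'D_(delta_mx 0 i) (fun y : 'rV[R]_p => h y 0 j) x).
  apply: Ck_sum => // j.
  apply: (CkM oO _ ((Ch j).2 i).2).
  by apply: (IHk ('D_(delta_mx 0 j) F)) => [j'|]; [exact: CkS|exact: (CF.2 j).2].
by apply: eq_Ck C' => // x /dc[_ ->].
Qed.

(** * The flat functions P(1/t) exp(-1/t) *)

Section FlatFunction.
Context {R : realType}.
Implicit Types (P : {poly R}) (s t : R).

(** With all polynomials P allowed, the family is stable under derivation. *)
Definition flat P t : R := if 0 < t then P.[t^-1] * expR (- t^-1) else 0.

(** Each monomial is bounded by one term of the exponential series. *)
Lemma horner_le_expR P : exists2 C : R, 0 <= C &
  forall s : R, 0 <= s -> `|P.[s]| <= C * expR s.
Proof.
exists (\sum_(i < size P) `|P`_i| * i`!%:R) => [|s s0].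
  by apply: sumr_ge0 => i _; rewrite mulr_ge0.
rewrite horner_coef mulr_suml (le_trans (ler_norm_sum _ _ _)) //.
apply: ler_sum => i _; rewrite normrM -mulrA ler_wpM2l // normrX ger0_norm //.
have f0 : 0 < i`!%:R :> R by rewrite ltr0n fact_gt0.
rewrite -ler_pdivrMl // mulrC.
case: (nat_of_ord i) => [|k]; last first.
  by apply: le_trans (expR_ge1Dxn k s0); rewrite lerDr.
by rewrite expr0 fact0 divr1 (le_trans _ (expR_ge1Dx s)) // lerDl.
Qed.

(** Apply the bound by the exponential to s^2 P(s), at s = 1/t: the two extra
powers become the factor t^2, which gives differentiability at 0. *)
Lemma flat_quadratic P : exists2 C : R, 0 <= C & forall t, `|flat P t| <= C * t ^+ 2.
Proof.
have [C C0 PC] := horner_le_expR ('X^2 * P); exists C => // t.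
rewrite /flat; case: ifP => [t0|_]; last by rewrite normr0 mulr_ge0 ?sqr_ge0.
have s0 : 0 <= t^-1 by rewrite invr_ge0 ltW.
have := PC _ s0; rewrite hornerM hornerXn normrM normrX ger0_norm // => H.
rewrite normrM (ger0_norm (expR_ge0 _)) expRN ler_pdivrMr ?expR_gt0 //.
by move: H; rewrite exprVn mulrC ler_pdivrMr ?exprn_gt0 // mulrAC.
Qed.

Lemma flat_gt0 t : 0 < t -> 0 < flat 1 t.
Proof. by move=> t0; rewrite /flat t0 hornerC mul1r expR_gt0. Qed.

Lemma flat_le0 P t : t <= 0 -> flat P t = 0.
Proof. by rewrite /flat leNgt => /negbTE ->. Qed.

(** For t > 0 and s = 1/t, the derivative of P(s) exp(-s) with respect to t is
(P(s) - P'(s)) s^2 exp(-s). *)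
Lemma is_derive_flat P t :
  is_derive t 1 (flat P) (flat ('X^2 * (P - P^`()%R)) t).
Proof.
have [t0|t0|->] := ltgtP t 0.
- rewrite (flat_le0 _ (ltW t0)).
  apply: (@near_eq_is_derive R R R (cst (0 : R))).
  have : \forall y \near t, y < 0 by apply: open_nbhs_nbhs; split.
  by apply: filterS => y /ltW y0; rewrite flat_le0.
- apply: (@near_eq_is_derive _ _ _ (fun y : R => P.[y^-1] * expR (- y^-1))).
    have : \forall y \near t, 0 < y by apply: open_nbhs_nbhs; split.
    by apply: filterS => y y0; rewrite /flat y0.
  have dV : is_derive t 1 (fun y : R => y^-1) (- t ^- 2).
    have := @is_deriveV R id t 1 1 (lt0r_neq0 t0) (is_derive_id _ _).
    by rewrite [_ *: 1]mulr1.
  have dVN : is_derive t 1 (fun y : R => - y^-1) (t ^- 2).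
    by have := is_deriveN dV; rewrite opprK.
  have d1 := is_derive1_comp (is_derive_poly P t^-1) dV.
  have d2 := @is_derive1_comp _ expR (fun y => - y^-1) t _ _ (is_derive_expR _) dVN.
  apply: (is_derive_eq (is_deriveM d1 d2)).
  rewrite -[LHS]/(P.[t^-1] * (expR (- t^-1) * t ^- 2)
    + expR (- t^-1) * (P^`()%R.[t^-1] * - t ^- 2)).
  by rewrite /flat t0 hornerM hornerXn hornerD hornerN exprVn; ring.
have [C C0 PC] := flat_quadratic P.
rewrite flat_le0 //.
have lim : h^-1 *: (flat P (h *: 1 + 0) - flat P 0) @[h --> 0^'] --> (0 : R).
  have z : C * `|h| @[h --> (0 : R)^'] --> C * `|0 : R|.
    apply: (@continuous_withinNx _ _ (fun h : R => C * `|h|) 0).1.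
    by apply: cvgM; [exact: cvg_cst|exact: norm_continuous].
  rewrite normr0 mulr0 in z.
  apply/norm_cvg0P; apply: squeeze_cvgr (cvg_cst 0) z.
  near=> h; rewrite normr_ge0 /= [h *: 1]mulr1 addr0 (flat_le0 _ (lexx 0)) subr0.
  have h0 : h != 0 by near: h; exact: nbhs_dnbhs_neq.
  rewrite normrM normfV ler_pdivrMl ?normr_gt0 // (le_trans (PC h)) //.
  by rewrite -real_normK ?num_real // expr2 mulrCA.
by split; [exact: cvgP lim|exact: cvg_lim lim].
Unshelve. all: by end_near. Qed.

End FlatFunction.

(** * Bump functions on boxes *)

Section Bump.
Context {R : realType} {m : nat}.
Implicit Types (O : set 'rV[R]_m) (p x : 'rV[R]_m) (r : R).

Definition box p r : set 'rV[R]_m := [set x | forall j, `|x 0 j - p 0 j| <= r].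

Lemma box_compact p r : compact (box p r).
Proof.
have -> : box p r = [set x | forall j, `[p 0 j - r, p 0 j + r]%classic (x 0 j)].
  by apply/seteqP; split=> x xr j; have := xr j; rewrite /= in_itv /= ler_distl.
apply: (@rV_compact R m (fun j => `[p 0 j - r, p 0 j + r]%classic)) => j.
exact: segment_compact.
Qed.

Lemma box_subset_open O p : open O -> O p -> exists2 r, 0 < r & box p r `<=` O.
Proof.
move=> oO Op; have /nbhs_ballP[e /= e0 pO] := open_nbhs_nbhs (conj oO Op).
exists (e / 2) => [|x xp]; first by rewrite divr_gt0.
apply: pO; rewrite -ball_normE /= distrC.
rewrite (@le_lt_trans _ _ (e / 2)) ?ltr_pdivrMr ?ltr_pMr ?ltr1n //.
by apply: norm_le_coord => [|j]; rewrite ?mxE ?divr_ge0 // ltW.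
Qed.

Definition box_bump p r x : R := \prod_j flat 1 (r ^+ 2 - (x 0 j - p 0 j) ^+ 2).

Lemma box_bump_smooth O p r : open O -> smooth_on O (box_bump p r).
Proof.
move=> oO k; apply: Ck_prod => // j.
have CB : Ck k O ((fun x => x 0 j) - cst (p 0 j)).
  by apply: CkB => //; [exact: Ck_coord|exact: Ck_cst].
apply: (@Ck_comp_family _ _ _ _ _ flat (fun P => 'X^2 * (P - P^`()%R)) 1
  (cst (r ^+ 2) - ((fun x => x 0 j) - cst (p 0 j))
    * ((fun x => x 0 j) - cst (p 0 j)))) => //.
  exact: is_derive_flat.
by apply: CkB => //; [exact: Ck_cst|exact: CkM].
Qed.

Lemma box_bump_center p r : 0 < r -> 0 < box_bump p r p.
Proof.
move=> r0; apply: prodr_gt0 => j _; apply: flat_gt0.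
by rewrite subrr expr0n subr0 exprn_gt0.
Qed.

Lemma box_bump_outside p r x : 0 <= r -> ~ box p r x -> box_bump p r x = 0.
Proof.
move=> r0 /existsNP[j /negP]; rewrite -ltNge => rj.
rewrite /box_bump (bigD1 j) //= flat_le0 ?mul0r // subr_le0.
by rewrite -[leRHS]real_normK ?num_real // ler_sqr ?nnegrE // ltW.
Qed.

End Bump.

(** * Extending functions and coordinate fields from a chart by zero *)

Section ChartExtension.
Context {R : realType} {m : nat} (M : manifold R m).
Implicit Types (c d : chart R m M) (v w : 'rV[R]_m -> R) (p x : 'rV[R]_m).

Lemma chart_img_inv d x : chart_img d x -> chart_dom d (chart_inv d x).
Proof. by move=> [q dq <-]; rewrite chart_mapK. Qed.

Lemma chart_invK d x : chart_img d x -> chart_map d (chart_inv d x) = x.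
Proof. by move=> [q dq <-]; rewrite chart_mapK. Qed.

Lemma chart_overlapE c d : chart_map c @` (chart_dom c `&` chart_dom d) =
  chart_img c `&` (chart_inv c @^-1` chart_dom d).
Proof.
apply/seteqP; split=> [x [q [cq dq] <-]|x [cx dx]].
  by split; [exists q|rewrite /= chart_mapK].
by exists (chart_inv c x); [split=> //; exact: chart_img_inv|exact: chart_invK].
Qed.

Lemma chart_preimage_open c (U : set M) : open U ->
  open (chart_img c `&` (chart_inv c @^-1` U)).
Proof.
move=> oU; rewrite openE => x [cx Ux].
apply: filterI; first by apply: open_nbhs_nbhs; split=> //; exact: chart_img_open.
by apply: (chart_inv_cont cx); exact: open_nbhs_nbhs.
Qed.

Definition chart_extension d v (q : M) : R :=
  if `[< chart_dom d q >] then v (chart_map d q) else 0.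

Lemma chart_extensionE d v x : chart_img d x ->
  chart_extension d v (chart_inv d x) = v x.
Proof.
move=> dx; rewrite /chart_extension chart_invK //.
by have /asboolP -> := chart_img_inv dx.
Qed.

(** In another chart, the points of the domain of [d] are handled by the smooth
change of coordinates.  The other points lie in the complement of the image of
K, which is open since a compact subset of a Hausdorff space is closed, and
there the extension vanishes. *)
Lemma chart_extension_smooth d v (K : set 'rV[R]_m) : atlas d ->
    compact K -> K `<=` chart_img d -> (forall x, ~ K x -> v x = 0) ->
  smooth_on (chart_img d) v -> chart_extension d v \in @smooth_fun_subdef R m M.
Proof.
move=> ad cK Kd v0 sv; apply/asboolP => c ac k.
have clK : closed (chart_inv d @` K).
  apply: compact_closed; first exact: manifold_hausdorff.
  apply: continuous_compact => //; apply: continuous_in_subspaceT => x.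
  by rewrite inE => /Kd; exact: chart_inv_cont.
apply: Ck_local => x cx.
have [dx|ndx] := pselect (chart_dom d (chart_inv c x)).
  exists (chart_img c `&` (chart_inv c @^-1` chart_dom d)); split => //.
    exact/chart_preimage_open/chart_dom_open.
  have oW := @chart_preimage_open c _ (@chart_dom_open _ _ _ d).
  apply: (eq_Ck oW (f := v \o (chart_map d \o chart_inv c))).
    by move=> y [_ dy]; rewrite /= /chart_extension; have /asboolP -> := dy.
  apply: (Ck_comp oW (@chart_img_open _ _ _ d)) (sv k) => [y [_ dy]|j].
    by exists (chart_inv c y).
  by rewrite -chart_overlapE; exact: atlas_compatible ac ad j k.
exists (chart_img c `&` (chart_inv c @^-1` ~` (chart_inv d @` K))); split.
- exact/chart_preimage_open/closed_openC.
- by split=> // -[y Ky yx]; apply: ndx; rewrite -yx; exact/chart_img_inv/Kd.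
have oW := @chart_preimage_open c _ (closed_openC clK).
apply: (eq_Ck oW (f := cst 0)); last exact: Ck_cst.
move=> y [_ nK]; rewrite /= /chart_extension; case: asboolP => // dy.
by rewrite v0 // => Ky; apply: nK; exists (chart_map d (chart_inv c y)) => //;
  rewrite chart_mapK.
Qed.

Lemma smooth_chart d (u : smooth_fun M) : atlas d ->
  smooth_on (chart_img d) (u \o chart_inv d).
Proof. by move=> ad; have /asboolP := smooth_funP u; exact. Qed.

(** The field w d/dx_i, for a function w with compact support in a chart. *)
Lemma chart_coordinate_field d w (K : set 'rV[R]_m) (i : 'I_m) : atlas d ->
    compact K -> K `<=` chart_img d -> (forall x, ~ K x -> w x = 0) ->
    smooth_on (chart_img d) w ->
  exists X : vfield M, forall (u : smooth_fun M) x, chart_img d x ->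
    X u (chart_inv d x) = w x * 'D_(delta_mx 0 i) (u \o chart_inv d) x.
Proof.
move=> ad cK Kd w0 sw.
have S (u : smooth_fun M) : chart_extension d
    (w * 'D_(delta_mx 0 i) (u \o chart_inv d)) \in @smooth_fun_subdef R m M.
  apply: (chart_extension_smooth ad cK Kd) => [x Kx|k].
    by rewrite fctE w0 ?mul0r.
  by apply: CkM (sw k) _; [exact: chart_img_open|exact: ((smooth_chart u ad k.+1).2 i).2].
pose X (u : smooth_fun M) : (smooth_fun M)^o := SmoothFun (S u).
have dX (u : smooth_fun M) x : chart_img d x ->
    derivable (u \o chart_inv d) x (delta_mx 0 i).
  exact: ((smooth_chart u ad 1).2 i).1.
suff XP : X \in @derivation_subdef R m M.
  by exists (VField XP) => u x dx; exact: chart_extensionE.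
apply/asboolP; split=> [a u v|u v]; apply: val_inj; apply/funext => q.
  rewrite -[LHS]/(chart_extension _ _ q).
  rewrite -[RHS]/(a * chart_extension d _ q + chart_extension d _ q).
  rewrite /chart_extension; case: asboolP => [dq|_]; last by rewrite mulr0 addr0.
  have iq : chart_img d (chart_map d q) by exists q.
  have D : 'D_(delta_mx 0 i) ((smooth_cst M a * u + v) \o chart_inv d) (chart_map d q) =
      a * 'D_(delta_mx 0 i) (u \o chart_inv d) (chart_map d q)
      + 'D_(delta_mx 0 i) (v \o chart_inv d) (chart_map d q).
    rewrite -[_ \o _]/(a \*: (u \o chart_inv d) + (v \o chart_inv d)).
    by rewrite deriveD ?deriveZ //; [exact: dX|exact: derivableZ (dX _ _ _)|exact: dX].
  rewrite -[LHS]/(w _ * 'D_(delta_mx 0 i) (_ \o chart_inv d) _) D.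
  by rewrite mulrDr mulrCA.
rewrite -[LHS]/(chart_extension _ _ q).
rewrite -[RHS]/(u q * chart_extension d _ q + v q * chart_extension d _ q).
rewrite /chart_extension; case: asboolP => [dq|_]; last by rewrite !mulr0 addr0.
have iq : chart_img d (chart_map d q) by exists q.
have D : 'D_(delta_mx 0 i) ((u * v : smooth_fun M) \o chart_inv d) (chart_map d q) =
    u q * 'D_(delta_mx 0 i) (v \o chart_inv d) (chart_map d q)
    + v q * 'D_(delta_mx 0 i) (u \o chart_inv d) (chart_map d q).
  rewrite -[_ \o _]/((u \o chart_inv d) * (v \o chart_inv d)).
  by rewrite deriveM; [rewrite /= chart_mapK|exact: dX|exact: dX].
rewrite -[LHS]/(w _ * 'D_(delta_mx 0 i) (_ \o chart_inv d) _) D.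
by rewrite mulrDr ![w _ * (_ * _)]mulrCA.
Qed.

(** Take X_i = b d/dx_i and u_j = b (x_j - p_j) for a bump function b around the
point p.  The factor x_j - p_j vanishes at p, so derivatives of b do not
contribute there and X_i u_j is b(p)^2 times the Kronecker symbol at p. *)
Lemma exists_dual_pairs : exists (q : M) (X : 'I_m -> vfield M)
    (u : 'I_m -> smooth_fun M) (a : R), a != 0 /\
  forall i j, X i (u j) q = a * (i == j)%:R.
Proof.
have [q _] := manifold_nonempty M; have [d ad dq] := atlas_cover q.
pose p := chart_map d q; have ip : chart_img d p by exists q.
have od := @chart_img_open _ _ _ d.
have [r r0 rd] := box_subset_open od ip.
have cK := @box_compact _ _ p r.
pose b := box_bump p r.
have b0 x : ~ box p r x -> b x = 0 by apply: box_bump_outside; exact: ltW.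
have sb : smooth_on (chart_img d) b by exact: box_bump_smooth.
pose l (j : 'I_m) : 'rV[R]_m -> R := (fun x => x 0 j) - cst (p 0 j).
have sl j : smooth_on (chart_img d) (l j).
  by move=> k; apply: CkB => //; [exact: Ck_coord|exact: Ck_cst].
have S j : chart_extension d (b * l j) \in @smooth_fun_subdef R m M.
  apply: (chart_extension_smooth ad cK rd) => [x Kx|k].
    by rewrite fctE b0 ?mul0r.
  by apply: CkM => //; exact: sl.
have [X XP] := choice (fun i => chart_coordinate_field i ad cK rd b0 sb).
exists q, X, (fun j => SmoothFun (S j)), (b p * b p).
have bp : 0 < b p by exact: box_bump_center.
split=> [|i j]; first by rewrite mulf_neq0 ?gt_eqF.
have -> : q = chart_inv d p by rewrite chart_mapK.
rewrite XP // -mulrA; congr (_ * _).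
transitivity ('D_(delta_mx 0 i) (b * l j) p).
  apply: near_eq_derive; have := open_nbhs_nbhs (conj od ip).
  by apply: filterS => x dx; exact: chart_extensionE.
rewrite deriveM; [|exact: ((sb 1).2 i).1|exact: ((sl j 1).2 i).1].
have [dj Dj] := is_derive_coord p (delta_mx 0 i) j.
rewrite deriveB // Dj derive_cst subr0 /l !fctE /= subrr scale0r addr0.
by rewrite mxE eqxx /= eq_sym.
Qed.

(** If X_0 = a_0 xi and X_1 = a_1 xi, then the matrix (X_i u_j) has rank at most
one at the given point, whereas it is a nonzero scalar matrix. *)
Lemma exists_vfield_not_multiple (xi : vfield M) : (1 < m)%N ->
  exists X : vfield M, forall a : smooth_fun M, X != a *: xi.
Proof.
move=> m1; have [q [X [u [w [w0 XuE]]]]] := exists_dual_pairs.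
apply: contrapT => H.
have mul i : exists a : smooth_fun M, X i = a *: xi.
  apply: contrapT => H'; apply: H; exists (X i) => a; apply/eqP => e.
  by apply: H'; exists a.
have [a aE] := choice mul.
have E i j : a i q * xi (u j) q = w * (i == j)%:R by rewrite -XuE aE.
pose i0 := Ordinal (ltnW m1); pose i1 := Ordinal m1.
have E00 := E i0 i0; have E10 := E i1 i0; have E11 := E i1 i1.
move: E00 E10 E11; rewrite !eqxx (_ : (i1 == i0) = false) // mulr1 mulr0.
move=> E00 /eqP; rewrite mulf_eq0 => /orP[/eqP ->|/eqP x0].
  by rewrite mul0r => /esym/eqP; rewrite (negbTE w0).
by move: E00 w0; rewrite x0 mulr0 => <-; rewrite eqxx.
Qed.

End ChartExtension.

(** * The theorem *)

Theorem theorem4p3 (R : realType) (n : nat) (hn : (0 < n)%N)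
    (M : manifold R (2 * n).+1)
    (phi : {linear vfield M -> vfield M}) (xi : vfield M)
    (eta : {linear vfield M -> (smooth_fun M)^o})
    (g : vfield M -> vfield M -> smooth_fun M)
    (nabla : vfield M -> vfield M -> vfield M)
    (S : vfield M -> vfield M -> smooth_fun M)
    (kappa mu : R) (beta lambda : M -> R)
    (f : smooth_fun M) (theta : {linear vfield M -> (smooth_fun M)^o}) :
  kappa_mu_almost_coKahler kappa mu phi xi eta g nabla ->
  is_ricci g nabla S ->
  beta_almost_ricci_soliton beta lambda g S xi ->
  torse_forming nabla xi f theta ->
  [/\ concurrent nabla xi,
      eta_Einstein g eta S &
      forall c : R, f = smooth_cst M c ->
        kappa <= 0 /\ c ^+ 2 = - 2 * kappa].
Proof.
move=> km _ sol tf.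
have ack := km_ack km; have lc := km_levi_civita km; have acm := ack_acm ack.
have cxi := torse_forming_reeb_concurrent ack lc tf.
split=> // [|c fc].
  exists (S xi xi), 0 => X Y; rewrite mul0r addr0.
  exact: (concurrent_soliton_einstein lc cxi (acm_unit acm) sol).
have m1 : (1 < (2 * n).+1)%N by rewrite ltnS muln_gt0.
have [X XP] := exists_vfield_not_multiple xi m1.
have scale0 a : smooth_cst M a *: (X - (eta X : smooth_fun M) *: xi) = 0 -> a = 0.
  apply: contraPeq => a0 /(smooth_cst_scale_eq0 a0)/eqP; rewrite subr_eq0.
  by rewrite (negbTE (XP _)).
have c0 : c = 0.
  by apply: scale0; rewrite -fc; exact: torse_factor_horizontal ack lc tf X.
have k0 : kappa = 0.
  apply: scale0; have := km_curvature km X xi.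
  rewrite (concurrent_curvature lc cxi) !(torse_forming_h_tensor0 ack lc tf).
  by rewrite (acm_eta_xi acm) !scaler0 subr0 scaler0 addr0 scale1r.
by rewrite c0 k0 lexx expr0n mulr0.
Qed.
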